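(* Let $C=(C_n)_{n\ge1}$ be a strong divisibility sequence, let $p$ be an ideal prime for $C$ (with associated integer $s(p)\ge1$), let $k\ge2$ be an integer, and let $e=\begin{bmatrix}1&0&\cdots&0\end{bmatrix}\in\mathbb{Z}^k$. Then for any integer $n\ge0$ with standard base-$p$ representation $n=n_\ell\cdots n_1n_0$, and for any integer $0\le r<\alpha(p)$, \[ T_{p,k,C}(\alpha(p)\cdot n+r,x)=u_{p,k,C}(r)\,M_{p,k}(n_0)M_{p,k}(n_1)\cdots M_{p,k}(n_\ell)\,e^{\intercal}, \] where $u_{p,k,C}(r)=\begin{bmatrix}u_{p,k,C,0}(r)&u_{p,k,C,1}(r)&\cdots&u_{p,k,C,k-1}(r)\end{bmatrix}$ with \[ u_{p,k,C,\lambda}(r)=x^{(s(p)-1)\lambda}\sum_{j=0}^{\lambda}(-1)^j\binom{k}{j}\binom{r+(\lambda-j)\alpha(p)+k-1}{k-1}. \]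
   Context: A strong divisibility sequence is a sequence $C=C_1,C_2,\dots$ of nonzero integers with $\gcd(C_n,C_m)=C_{\gcd(n,m)}$ for all positive $n,m$. The $C$-orial is $0!_C=1$, $n!_C=C_nC_{n-1}\cdots C_1$ for $n\ge1$. For $\mathbf m=(m_1,\dots,m_k)\in\mathbb N^k$ ($\mathbb N$ includes $0$) write $\operatorname{tot}\mathbf m=m_1+\cdots+m_k$; for $\operatorname{tot}\mathbf m=n$ the $C$-multinomial is $\binom{n}{m_1,\dots,m_k}_C=\frac{n!_C}{m_1!_C\cdots m_k!_C}$. For a prime $p$, $\nu_p$ is the $p$-adic valuation and $T_{p,k,C}(n,x)=\sum_{\mathbf m\in\mathbb N^k,\ \operatorname{tot}\mathbf m=n}x^{\nu_p(\binom{n}{m_1,\dots,m_k}_C)}$. The rank of apparition $\alpha(m)$ is the least index $j\ge1$ with $m\mid C_j$ (if it exists). When $\alpha(p^k)$ exists for all $k\ge1$, set $a_k(p)=\alpha(p^k)/\alpha(p^{k-1})$ for $k\ge2$. The prime $p$ is ideal for $C$ if $\alpha(p^k)$ exists for all $k\ge1$ and there is an integer $s(p)\ge1$ with $a_k(p)=1$ for $2\le k\le s(p)$ and $a_k(p)=p$ for $k>s(p)$. For $d\in\{0,\dots,p-1\}$, $M_{p,k}(d)$ is the $k\times k$ matrix with rows and columns indexed by $\mu,\lambda\in\{0,1,\dots,k-1\}$ whose $(\mu,\lambda)$ entry is $x^{\mu}N_{p,k}(d-\mu+\lambda p)$, where $N_{p,k}(t)$ denotes the number of tuples $(d_1,\dots,d_k)\in\{0,1,\dots,p-1\}^k$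 with $d_1+\cdots+d_k=t$ (so $N_{p,k}(t)=0$ for $t<0$). *)

(* Defs.v *)
From mathcomp Require Import all_boot all_order all_algebra.
From mathcomp Require Import boolp.
Set Implicit Arguments.
Unset Strict Implicit.
Unset Printing Implicit Defensive.
Import Order.TTheory GRing.Theory Num.Theory.
Local Open Scope ring_scope.

(* A sequence C_1, C_2, ... is a function C : nat -> int whose value at 0 is
   never used.  The gcd of two integers is only defined up to sign, whereas
   gcdz is the nonnegative representative; the absolute value on the right
   allows terms of either sign. *)
Definition strong_divisibility (C : nat -> int) : Prop :=
  (forall n, (0 < n)%N -> C n != 0) /\
  (forall n m, (0 < n)%N -> (0 < m)%N -> gcdz (C n) (C m) = `|C (gcdn n m)|).

Definition orial (C : nat -> int) (n : nat) : int := \prod_(1 <= i < n.+1) C i.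

Definition tot (k : nat) (m : 'I_k -> nat) : nat := (\sum_i m i)%N.

(* The Euclidean quotient is the exact one by multinomial_exact below. *)
Definition multinomial (C : nat -> int) (n k : nat) (m : 'I_k -> nat) : int :=
  (orial C n %/ \prod_i orial C (m i))%Z.

Definition nu (p : nat) (z : int) : nat := logn p `|z|%N.

(* Since tot m = n bounds every m_i by n, the tuples range over
   {0, ..., n}^k. *)
Definition T (p k : nat) (C : nat -> int) (n : nat) : {poly int} :=
  \sum_(m : {ffun 'I_k -> 'I_n.+1} | tot (fun i => m i) == n)
    'X^(nu p (multinomial C n (fun i => m i))).

Definition apparition (C : nat -> int) (m j : nat) : bool :=
  (0 < j)%N && (m%:Z %| C j)%Z.

Definition has_rank (C : nat -> int) (m : nat) : Prop :=
  exists j, apparition C m j.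

(* The rank of apparition alpha(m), with junk value 0 when it does not exist. *)
Definition rank (C : nat -> int) (m : nat) : nat :=
  if pselect (has_rank C m) is left h then ex_minn h else 0%N.

Definition rank_ratio (C : nat -> int) (p k : nat) : rat :=
  (rank C (p ^ k)%N)%:R / (rank C (p ^ k.-1)%N)%:R.

Definition ideal_prime (C : nat -> int) (p s : nat) : Prop :=
  [/\ prime p,
      forall k, (1 <= k)%N -> has_rank C (p ^ k)%N,
      (1 <= s)%N,
      forall k, (2 <= k <= s)%N -> rank_ratio C p k = 1
    & forall k, (s < k)%N -> rank_ratio C p k = p%:R].

Definition digit_sums (p k : nat) (t : int) : nat :=
  #|[set d : {ffun 'I_k -> 'I_p} | (tot (fun i => d i))%:Z == t]|.

Definition M (p k d : nat) : 'M[{poly int}]_k :=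
  \matrix_(mu < k, lambda < k)
    ('X^mu * (digit_sums p k (d%:Z - mu%:Z + (lambda * p)%N%:Z))%:R).

Definition u_coef (p k : nat) (C : nat -> int) (s r lambda : nat) :
    {poly int} :=
  'X^((s - 1) * lambda)%N *
  \sum_(0 <= j < lambda.+1)
     (-1) ^+ j * 'C(k, j)%:R *
     'C((r + (lambda - j) * rank C p + k - 1)%N, (k - 1)%N)%:R.

Definition u (p k : nat) (C : nat -> int) (s r : nat) : 'rV[{poly int}]_k :=
  \row_(lambda < k) u_coef p k C s r lambda.

Definition e (k : nat) : 'rV[{poly int}]_k :=
  \row_(i < k) ((i : nat) == 0%N)%:R.

(* n = n_l ... n_1 n_0 in base p, without leading zeros except for n = 0,
   which is written with the single digit 0. *)
Definition base_rep (p n l : nat) (d : 'I_l.+1 -> 'I_p) : Prop :=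
  n = (\sum_(i < l.+1) d i * p ^ i)%N /\ ((0 < l)%N -> d ord_max != 0%N :> nat).

Lemma orialS C n : orial C n.+1 = orial C n * C n.+1.
Proof. by rewrite /orial big_nat_recr. Qed.

Lemma dvdz_orialD C m n : strong_divisibility C ->
  (orial C m * orial C n %| orial C (m + n))%Z.
Proof.
move=> [_ gcdC]; have [N] := ubnP (m + n); elim: N m n => // N IH.
have o0 : orial C 0 = 1 by rewrite /orial big_nil.
move=> [|m] [|n] leN; rewrite ?addn0 ?add0n ?o0 ?mulr1 ?mul1r //.
rewrite addSn orialS.
have dC : (gcdz (C m.+1) (C n.+1) %| C (m + n.+1).+1)%Z.
  rewrite gcdC // -addSn dvdzE absz_id -dvdzE.
  have : (gcdn m.+1 n.+1 %| m.+1 + n.+1)%N by rewrite dvdn_add ?dvdn_gcdl ?dvdn_gcdr.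
  set g := gcdn _ _ => gd; have g0 : (0 < g)%N by rewrite gcdn_gt0.
  have := gcdC g (m.+1 + n.+1)%N g0 isT; rewrite (gcdn_idPl gd) => E.
  have Eg : `|gcdz (C g) (C (m.+1 + n.+1)%N)|%N = `|C g|%N.
    by rewrite E -abszE absz_nat.
  by rewrite dvdzE -Eg -dvdzE dvdz_gcdr.
apply: (@dvdz_trans (orial C (m + n.+1) * gcdz (C m.+1) (C n.+1))); last first.
  by rewrite dvdz_mul.
suff : (orial C m.+1 * orial C n.+1 %|
    gcdz (orial C (m + n.+1) * C m.+1) (orial C (m + n.+1) * C n.+1))%Z.
  by rewrite -mulz_gcdr; rewrite !dvdzE !abszM absz_id.
rewrite dvdz_gcd; apply/andP; split.
  by rewrite orialS mulrAC dvdz_mul // IH // -ltnS -addSn.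
by rewrite [orial C n.+1]orialS mulrA dvdz_mul // -addSnnS IH // addSn -ltnS -addnS -addSn.
Qed.

Lemma multinomial_exact C n k (m : 'I_k -> nat) :
  strong_divisibility C -> tot m = n ->
  multinomial C n m * \prod_i orial C (m i) = orial C n.
Proof.
move=> sdC <-; rewrite /multinomial divzK // /tot.
elim/big_ind2: _ => // a b x y da dx.
exact: dvdz_trans (dvdz_mul da dx) (dvdz_orialD _ _ sdC).
Qed.

(* Main.v *)
(* For an ideal prime, nu_p(n!_C) = s floor(n/alpha) + nu_p(floor(n/alpha)!),
   and likewise nu_p(n!) = floor(n/p) + nu_p(floor(n/p)!).  Dividing every part
   m_i of a composition of n by alpha, and then repeatedly by p, separates
   quotients from remainders; the sum of the remainders is the current digit
   of n corrected by a carry in from the previous digit and a carry out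
   lambda < k to the next one.  Recording the carry gives one and the same
   recursion for both kinds of step: the matrices M for base p, and the row u
   for the initial division by alpha.  The compositions counted by u are the
   coefficients of (1 + ... + X^(alpha-1))^k = (1 - X^alpha)^k (1 - X)^(-k). *)
Require Import Defs.
From mathcomp Require Import all_boot all_order all_algebra.
From mathcomp Require Import boolp zify ring.
Set Implicit Arguments.
Unset Strict Implicit.
Unset Printing Implicit Defensive.
Import Order.TTheory GRing.Theory Num.Theory.
Local Open Scope ring_scope.

(** * Valuations of factorials *)

(** Only multiples of [a] contribute, the [i]-th one giving [c + logn p i]. The case [a = p],
    [c = 1] is Legendre's recursion; [a = rank C p], [c = s] serves the [C]-orial. *)
Lemma sum_logn_fact (p a c : nat) (v : nat -> nat) : (0 < a)%N ->
  (forall n, v n.+1 = if a %| n.+1 then c + logn p (n.+1 %/ a) else 0)%N ->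
  forall n, (\sum_(1 <= i < n.+1) v i = c * (n %/ a) + logn p (n %/ a)`!)%N.
Proof.
move=> a0 vE; elim=> [|n IH]; first by rewrite big_nil div0n logn1 muln0.
rewrite big_nat_recr //= IH vE divnS //.
case: (a %| n.+1)%N => /=; last by rewrite add0n addn0.
by rewrite add1n factS lognM ?fact_gt0 //; lia.
Qed.

Lemma logn_fact_divn p n : prime p ->
  logn p n`! = (n %/ p + logn p (n %/ p)`!)%N.
Proof.
move=> pr; rewrite -[X in (X + _)%N]mul1n -(@sum_logn_fact p p 1 (logn p)) ?prime_gt0 //.
  elim: n => [|n IH]; first by rewrite big_nil logn1.
  by rewrite factS lognM ?fact_gt0 // IH [in RHS]big_nat_recr //= addnC.
move=> m; case: ifP => [/dvdnP[q E]|nd]; last by rewrite lognE pr nd.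
have q0 : (0 < q)%N by case: q E.
have p0 := prime_gt0 pr.
by rewrite E mulnK // lognM // (logn_prime p pr) eqxx addnC.
Qed.

Lemma leq_logn_fact p m n : (m <= n)%N -> (logn p m`! <= logn p n`!)%N.
Proof.
move=> le; apply: dvdn_leq_log; rewrite ?fact_gt0 //.
by rewrite -(bin_fact le) mulnCA dvdn_mulr.
Qed.

Lemma sum_logn_fact_le p k (q : 'I_k -> nat) :
  (\sum_i logn p (q i)`! <= logn p (tot q)`!)%N.
Proof.
rewrite /tot; elim/big_ind2: _ => // m1 n1 m2 n2 le1 le2.
apply: leq_trans (leq_add le1 le2) _.
rewrite -lognM ?fact_gt0 //; apply: dvdn_leq_log; rewrite ?fact_gt0 //.
by rewrite -(bin_fact (leq_addr m2 m1)) addKn dvdn_mull.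
Qed.

(** * Ranks of apparition and valuations of [C]-orials *)

Section Rank.
Variables (C : nat -> int) (sdC : strong_divisibility C).

Lemma rankP m : has_rank C m ->
  [/\ (0 < rank C m)%N, (m%:Z %| C (rank C m))%Z
    & forall j, (0 < j)%N -> (m%:Z %| C j)%Z -> (rank C m <= j)%N].
Proof.
rewrite /rank => h; case: pselect => // h'.
case: ex_minnP => j /andP[j0 dj] jmin; split=> // i i0 di.
by apply: jmin; rewrite /apparition i0 di.
Qed.

(** If [m] divides [C n], it divides the gcd of [C n] and [C (rank C m)], which up to sign is the
    term at the gcd of the two indices; minimality of the rank forces that gcd to be the rank
    itself. *)
Lemma dvdz_rank m n : has_rank C m -> (0 < n)%N ->
  (m%:Z %| C n)%Z = (rank C m %| n)%N.
Proof.
move=> /rankP[r0 dr rmin] n0.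
have E := sdC.2 _ _ r0 n0.
apply/idP/idP => [dn|/gcdn_idPl g].
  have g0 : (0 < gcdn (rank C m) n)%N by rewrite gcdn_gt0 r0.
  have : (rank C m <= gcdn (rank C m) n)%N.
    apply: rmin => //; have := dvdz_gcd m%:Z (C (rank C m)) (C n).
    by rewrite dr dn E /= !dvdzE -abszE absz_nat => ->.
  have := dvdn_gcdl (rank C m) n => /(dvdn_leq r0) le1 le2.
  by apply/gcdn_idPl/eqP; rewrite eqn_leq le1 le2.
apply: dvdz_trans dr _; rewrite g in E.
have := dvdz_gcdr (C (rank C m)) (C n).
by rewrite E !dvdzE -abszE absz_nat.
Qed.

Variables (p s : nat) (idp : ideal_prime C p s).

Lemma rank_gt0 : (0 < rank C p)%N.
Proof. by have [_ /(_ 1 isT)] := idp; rewrite expn1 => /rankP[]. Qed.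

(** Truncated subtraction merges the two regimes: the exponent stays 0 up to [s], then grows by one
    at each step. *)
Lemma rank_exp j : rank C (p ^ j.+1)%N = (rank C p * p ^ (j.+1 - s))%N.
Proof.
have [_ hr s0 r1 rp] := idp.
elim: j => [|j IH]; first by rewrite expn1 (eqP s0) muln1.
have q0 : (rank C (p ^ j.+1)%N)%:R != 0 :> rat.
  by rewrite pnatr_eq0 -lt0n; have [] := rankP (hr j.+1 isT).
have [le|lt] := leqP j.+2 s.
  have := r1 j.+2; rewrite le /rank_ratio /= => /(_ isT)/divr1_eq/eqP.
  rewrite eqr_nat IH => /eqP->; congr (_ * p ^ _)%N; lia.
have := rp j.+2 lt; rewrite /rank_ratio /= => /(canRL (divfK q0))/eqP.
rewrite -natrM eqr_nat IH => /eqP->.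
by rewrite (@subSn s j.+1 lt) expnS mulnCA.
Qed.

Lemma nu_ideal n : (0 < n)%N ->
  nu p (C n) =
    (if rank C p %| n then s + logn p (n %/ rank C p) else 0)%N.
Proof.
move=> n0; have [pr hr s0 _ _] := idp.
have C0 : (0 < `|C n|)%N by rewrite absz_gt0 (sdC.1 n n0).
(* A natural number is determined by the successors [j.+1] below or equal to it, so both sides are
   compared through these thresholds. *)
have P j : (j.+1 <= nu p (C n))%N = (rank C p * p ^ (j.+1 - s) %| n)%N.
  by rewrite -rank_exp -(dvdz_rank (hr j.+1 isT) n0) dvdzE absz_nat pfactor_dvdn.
case: ifP => [/dvdnP[m E]|nd]; last first.
  by apply/eqP; rewrite -leqn0 leqNgt P (eqP s0) muln1 nd.
rewrite E mulnK ?rank_gt0 //.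
have m0 : (0 < m)%N by case: m E n0 => [->|].
apply/eqP; rewrite eqn_leq.
have Q j : (j.+1 <= nu p (C n))%N = (j.+1 <= s + logn p m)%N.
  by rewrite P E mulnC dvdn_pmul2r ?rank_gt0 // pfactor_dvdn // leq_subLR.
rewrite -E; apply/andP; split; first by case: (nu p _) Q => // v /(_ v) <-.
by case: (s + _)%N Q => // v /(_ v) ->.
Qed.

Lemma orial_neq0 n : orial C n != 0.
Proof.
elim: n => [|n IH]; first by rewrite /orial big_nil.
by rewrite orialS mulf_neq0 // (sdC.1 n.+1).
Qed.

Lemma nuM x y : x != 0 -> y != 0 -> nu p (x * y) = (nu p x + nu p y)%N.
Proof. by move=> x0 y0; rewrite /nu abszM lognM ?absz_gt0. Qed.

Lemma nu_orial n :
  nu p (orial C n) =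
    (s * (n %/ rank C p) + logn p (n %/ rank C p)`!)%N.
Proof.
rewrite -(@sum_logn_fact p _ _ (fun i => nu p (C i))) ?rank_gt0 //; last first.
  by move=> m; rewrite nu_ideal.
elim: n => [|n IH]; first by rewrite /orial !big_nil /nu logn1.
by rewrite orialS nuM ?orial_neq0 ?(sdC.1 n.+1) // IH [in RHS]big_nat_recr.
Qed.

Lemma nu_multinomial k n (m : 'I_k -> nat) : tot m = n ->
  nu p (multinomial C n m) =
    (nu p (orial C n) - \sum_i nu p (orial C (m i)))%N.
Proof.
move=> E; have F := multinomial_exact sdC E.
have /andP[P0 PE] : (\prod_i orial C (m i) != 0) &&
    (nu p (\prod_i orial C (m i)) == \sum_i nu p (orial C (m i)))%N.
  elim/big_rec2: _ => [|i x y _ /andP[y0 /eqP <-]]; first by rewrite /nu logn1.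
  by rewrite mulf_neq0 ?orial_neq0 // nuM ?orial_neq0 /=.
rewrite -F nuM ?(eqP PE) ?addnK //.
by apply: contraNneq (orial_neq0 n) => Z; rewrite -F Z mul0r.
Qed.

End Rank.

(** * Reindexing sums over tuples *)

Section Tuples.
Variable V : nmodType.

Lemma sum_ffun_widen k b b' n (F : ('I_k -> nat) -> V) :
  (n < b)%N -> (b <= b')%N ->
  \sum_(m : {ffun 'I_k -> 'I_b'} | (tot (fun i => m i) <= n)%N)
      F (fun i => m i) =
  \sum_(m : {ffun 'I_k -> 'I_b} | (tot (fun i => m i) <= n)%N)
      F (fun i => m i).
Proof.
move=> ltb leb.
have b0 : (0 < b)%N by exact: leq_ltn_trans ltb.
pose h (m : {ffun 'I_k -> 'I_b}) : {ffun 'I_k -> 'I_b'} :=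
  [ffun i => widen_ord leb (m i)].
(* The default 0 of [insubd] is never reached where it matters: the constraint keeps every entry at
   most [n < b]. *)
pose h' (m : {ffun 'I_k -> 'I_b'}) : {ffun 'I_k -> 'I_b} :=
  [ffun i => insubd (Ordinal b0) (m i : nat)].
have hE m : (fun i => h m i : nat) = (fun i => m i : nat).
  by apply: funext => i; rewrite ffunE.
rewrite (reindex_onto h h') => [|m lem].
  apply: eq_big => [m|m _]; rewrite hE //.
  suff -> : h' (h m) = m by rewrite eqxx andbT.
  by apply/ffunP => i; apply: val_inj; rewrite !ffunE val_insubd /= ltn_ord.
apply/ffunP => i; apply: val_inj; rewrite !ffunE /= val_insubd ifT //.
by apply: leq_ltn_trans ltb; apply: leq_trans lem; rewrite /tot (bigD1 i) //= leq_addr.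
Qed.

Lemma sum_ffun_divmod k a b (F : ('I_k -> nat) -> V) : (0 < a)%N ->
  \sum_(m : {ffun 'I_k -> 'I_(b * a)}) F (fun i => m i) =
  \sum_(q : {ffun 'I_k -> 'I_b}) \sum_(t : {ffun 'I_k -> 'I_a})
     F (fun i => q i * a + t i)%N.
Proof.
move=> a0; rewrite pair_big /=.
have lt (q : 'I_b) (t : 'I_a) : (q * a + t < b * a)%N.
  by rewrite -ltn_divLR // divnMDl // divn_small // addn0.
have ltq (m : 'I_(b * a)) : (m %/ a < b)%N by rewrite ltn_divLR.
have ltt (m : 'I_(b * a)) : (m %% a < a)%N by rewrite ltn_mod.
pose h (u : {ffun 'I_k -> 'I_b} * {ffun 'I_k -> 'I_a}) :
  {ffun 'I_k -> 'I_(b * a)} := [ffun i => Ordinal (lt (u.1 i) (u.2 i))].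
pose h' (m : {ffun 'I_k -> 'I_(b * a)}) :=
  ([ffun i => Ordinal (ltq (m i))] : {ffun 'I_k -> 'I_b},
   [ffun i => Ordinal (ltt (m i))] : {ffun 'I_k -> 'I_a}).
rewrite (reindex_onto h h') => [|m _].
  apply: eq_big => [[q t]|[q t] _] /=; last by congr F; apply: funext => i; rewrite ffunE.
  apply/eqP; congr pair; apply/ffunP => i; apply: val_inj; rewrite !ffunE /= ?ffunE /=.
    by rewrite divnMDl // divn_small // addn0.
  by rewrite modnMDl modn_small.
by apply/ffunP => i; apply: val_inj; rewrite !ffunE /= ?ffunE /= -divn_eq.
Qed.

End Tuples.

(** * Carries and the digit recursion *)

(* The parts sum to [n - lambda], where [lambda] is the carry into the digits
   still to be read.  The truncated subtraction is exact for the [phi] used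
   here, which are superadditive. *)
Definition carry_sum (k : nat) (phi : nat -> nat) (n lambda : nat) :
    {poly int} :=
  \sum_(q : {ffun 'I_k -> 'I_n.+1} | (tot (fun i => q i) + lambda == n)%N)
    'X^(lambda + phi n - \sum_i phi (q i)).

(** Freeing the box size allows one that is a multiple of [a], as entrywise division by [a]
    requires. *)
Lemma carry_sum_box k phi b n lambda : (n < b)%N ->
  carry_sum k phi n lambda =
  \sum_(q : {ffun 'I_k -> 'I_b})
    if (tot (fun i => q i) + lambda == n)%N
    then 'X^(lambda + phi n - \sum_i phi (q i)) else 0.
Proof.
move=> ltb.
pose F (q : 'I_k -> nat) : {poly int} := if (tot q + lambda == n)%N
    then 'X^(lambda + phi n - \sum_i phi (q i)) else 0.
rewrite /carry_sum big_mkcond /=.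
have E b' : \sum_(q : {ffun 'I_k -> 'I_b'}) F (fun i => q i) =
    \sum_(q : {ffun 'I_k -> 'I_b'} | (tot (fun i => q i) <= n)%N) F (fun i => q i).
  rewrite [RHS]big_mkcond; apply: eq_bigr => q _.
  by case: leqP => // lt; rewrite /F ifF //; apply/eqP; lia.
by rewrite [LHS]E [RHS]E (@sum_ffun_widen _ k n.+1 b n F).
Qed.

Lemma tot_digits_le k a (t : {ffun 'I_k -> 'I_a}) :
  (tot (fun i => t i) + k <= k * a)%N.
Proof.
have E c : (k * c = \sum_(i < k) c)%N by rewrite sum_nat_const card_ord.
rewrite /tot -[X in (_ + X <= _)%N]muln1 !E -big_split /=.
by apply: leq_sum => i _; rewrite addn1.
Qed.

(** Write each part as [q i * a + t i]. The carry out must be [lambda = n - tot q], and then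
    [tot t = d - mu + lambda * a], which [digit_sums] counts. The exponent gains [c * lambda]: one
    [lambda] belongs to the inner [carry_sum], the rest is the explicit power. *)
Lemma carry_sum_rec k (phi psi : nat -> nat) a c n d mu :
  (d < a)%N -> (mu < k)%N -> (0 < c)%N ->
  (forall m, phi m = c * (m %/ a) + psi (m %/ a))%N ->
  (forall (q : 'I_k -> nat), tot q <= n -> \sum_i psi (q i) <= psi n)%N ->
  carry_sum k phi (a * n + d) mu =
  \sum_(lambda < k)
     'X^mu * (digit_sums a k (d%:Z - mu%:Z + (lambda * a)%N%:Z))%:R *
     ('X^((c - 1) * lambda) * carry_sum k psi n lambda).
Proof.
move=> da muk c0 phiE psi_le.
have a0 : (0 < a)%N by exact: leq_ltn_trans da.
rewrite (@carry_sum_box k phi (n.+1 * a)); last by rewrite mulSn mulnC addnC ltn_add2r.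
pose F (q : 'I_k -> nat) : {poly int} := if (tot q + mu == a * n + d)%N
    then 'X^(mu + phi (a * n + d)%N - \sum_i phi (q i)) else 0.
rewrite (@sum_ffun_divmod _ k a n.+1 F) // /F.
(* Summing over all [lambda] is harmless: for given [q] and [t] at most one carry gives a nonzero
   term. *)
pose H (q : {ffun 'I_k -> 'I_n.+1}) (t : {ffun 'I_k -> 'I_a}) (lambda : 'I_k)
  : {poly int} :=
  if (tot (fun i => q i) + lambda == n)%N &&
     (tot (fun i => t i) + mu == d + lambda * a)%N
  then 'X^(mu + ((c - 1) * lambda + (lambda + psi n - \sum_i psi (q i)))) else 0.
transitivity (\sum_q \sum_t \sum_lambda H q t lambda); last first.
  rewrite exchange_big /=.
  under eq_bigr do rewrite exchange_big /=.
  rewrite exchange_big /=; apply: eq_bigr => lambda _.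
  rewrite /carry_sum !big_distrr [RHS]big_mkcond /= exchange_big /=.
  apply: eq_bigr => q _; rewrite /H; case: eqP => [E|_]; last by rewrite big1.
  rewrite -big_mkcond /= sumr_const.
  rewrite (_ : #|_| = digit_sums a k (d%:Z - mu%:Z + (lambda * a)%N%:Z)).
    by rewrite -[LHS]mulr_natr !exprD mulrAC.
  rewrite /digit_sums; apply: eq_card => t; rewrite inE unfold_in.
  by apply/eqP/eqP; lia.
apply: eq_bigr => q _; apply: eq_bigr => t _.
set Q := tot (fun i => q i); set S := tot (fun i => t i).
have QS : tot (fun i => q i * a + t i)%N = (Q * a + S)%N.
  by rewrite /tot big_split big_distrl.
have Sk : (S + k <= k * a)%N := tot_digits_le t.
case: eqP => [E|nE]; last first.
  rewrite big1 // => lambda _; rewrite /H ifF //; apply/negP => /andP[/eqP E1 /eqP E2].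
  by apply: nE; rewrite QS -addnA E2 addnCA addnC -E1 mulnDr -/Q; lia.
rewrite QS in E.
have Qn : (Q <= n)%N by rewrite -ltnS -(ltn_pmul2r a0); nia.
(* The carry stays below [k]: [(n - Q) * a = S + mu - d], where [S <= k * a - k] and [mu < k]. *)
have ltk : (n - Q < k)%N by rewrite -(ltn_pmul2r a0) mulnBl; nia.
rewrite [RHS](bigD1 (Ordinal ltk)) //= [in RHS]big1 ?addr0 => [|i /eqP ni]; last first.
  rewrite /H ifF //; apply/negP => /andP[/eqP E1 _]; apply: ni; apply: val_inj => /=.
  by rewrite -/Q in E1; lia.
rewrite /H -/Q -/S /= subnKC // eqxx /= ifT; last by apply/eqP; rewrite mulnBl; nia.
congr 'X^_.
have -> : phi (a * n + d)%N = (c * n + psi n)%N.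
  by rewrite phiE (mulnC a n) divnMDl // (divn_small da) addn0.
have -> : (\sum_i phi (q i * a + t i) = c * Q + \sum_i psi (q i))%N.
  rewrite /Q /tot big_distrr -big_split /=; apply: eq_bigr => i _.
  by rewrite phiE divnMDl // divn_small // addn0.
(* This bound makes the truncated subtractions exact. *)
have := psi_le (fun i => q i) Qn.
move: (\sum_i _)%N (psi n) => x y; clear -c0 Qn; move: Q Qn => z lez.
case: c c0 => // c _; nia.
Qed.

Lemma carry_sum0 k phi lambda : phi 0 = 0%N ->
  carry_sum k phi 0 lambda = (lambda == 0%N)%:R.
Proof.
move=> phi0; rewrite /carry_sum.
have Z (q : {ffun 'I_k -> 'I_1}) : tot (fun i => q i) = 0%N.
  by rewrite /tot big1 // => i _; rewrite ord1.
under eq_bigl => q do rewrite Z add0n.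
case: eqP => [->|_]; last by rewrite big_pred0.
under eq_bigr do rewrite phi0 add0n sub0n expr0.
by rewrite sumr_const card_ffun !card_ord exp1n.
Qed.

(** Induction peels off the lowest digit; with [c = 1] the extra power of ['X] is trivial. Once no
    digits remain, only carry 0 survives, which gives [e]. *)
Lemma carry_sum_prod p k l (d : 'I_l -> 'I_p) : prime p ->
  \col_lambda carry_sum k (fun m => logn p m`!)
                (\sum_(i < l) d i * p ^ i)%N lambda =
  (\prod_(i < l) M p k (d i)) *m (e k)^T.
Proof.
move=> pr; elim: l d => [|l IH] d.
  rewrite !big_ord0 mul1mx; apply/matrixP => i j.
  by rewrite !mxE carry_sum0 // logn1.
rewrite !big_ord_recl -mulmxE -mulmxA -IH /=.
set n := (\sum_(i < l) d (lift ord0 i) * p ^ i)%N.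
have -> : (d ord0 * p ^ 0 + \sum_(i < l) d (lift ord0 i) * p ^ bump 0 i =
           p * n + d ord0)%N.
  rewrite muln1 addnC; congr addn; rewrite big_distrr /=.
  by apply: eq_bigr => i _; rewrite /bump leq0n add1n expnS mulnCA.
apply/matrixP => mu j; rewrite !mxE.
rewrite (@carry_sum_rec _ _ (fun m => logn p m`!) p 1) //.
- by apply: eq_bigr => lambda _; rewrite !mxE mul0n expr0 mul1r.
- by move=> m; rewrite mul1n logn_fact_divn.
- by move=> q le; apply: leq_trans (sum_logn_fact_le p q) (leq_logn_fact _ le).
Qed.

(** * Binomial formula for the initial row *)

(** A polynomial form of the expansion of [(1 - 'X)^(-k-1)], correct modulo ['X^b]. *)
Lemma binomial_series k b :
  exists R : {poly int},
    (1 - 'X) ^+ k.+1 * \poly_(t < b) ('C(t + k, k))%:R = 1 - 'X^b * R.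
Proof.
elim: k => [|k [R IH]].
  exists 1; rewrite expr1 poly_def mulr1 -opprB mulNr.
  under eq_bigr do rewrite bin0 scale1r.
  by rewrite -subrX1 opprB.
(* By Pascal's rule the product telescopes, leaving one boundary term at degree [b]. *)
have E : (1 - 'X) * \poly_(t < b) ('C(t + k.+1, k.+1))%:R =
    \poly_(t < b) ('C(t + k, k))%:R - 'X^b * ('C(b + k, k.+1))%:R :> {poly int}.
  rewrite !poly_def; elim: b {R IH} => [|b IH].
    by rewrite !big_ord0 bin_small // !mulr0 subr0.
  rewrite !big_ord_recr /= mulrDr IH addSn addnS !scaler_nat binS mulrnDr natrD.
  by rewrite -!(mulr_natr 'X^b) exprS; ring.
exists (R + (1 - 'X) ^+ k.+1 * ('C(b + k, k.+1))%:R).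
rewrite exprSr -mulrA E mulrBr IH mulrDr [in RHS]opprD addrA.
by rewrite [in LHS]mulrCA.
Qed.

Lemma coef_geometric_exp a k n :
  ((\sum_(i < a) 'X^i) ^+ k)`_n = (digit_sums a k n)%:R :> int.
Proof.
rewrite -{1}(card_ord k) -prodr_const bigA_distr_bigA /= coef_sum.
under eq_bigr do rewrite prodrXr coefXn.
rewrite /digit_sums -sum1_card natr_sum [RHS]big_mkcond /=.
by apply: eq_bigr => t _; rewrite inE eqz_nat eq_sym; case: eqP.
Qed.

Lemma digit_sums_binomial a k r lambda : (r < a)%N -> (lambda <= k.+1)%N ->
  (digit_sums a k.+1 (r + lambda * a)%N)%:R =
  \sum_(0 <= j < lambda.+1)
    (-1) ^+ j * 'C(k.+1, j)%:R * 'C(r + (lambda - j) * a + k, k)%:R :> int.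
Proof.
move=> ra lek; rewrite -coef_geometric_exp.
set t := (r + _)%N; set G := \sum_(i < a) _.
(* Truncating at [t.+1] makes the error invisible in the coefficient of degree [t]. *)
have [R E] := binomial_series k t.+1.
set Q := \poly_(_ < _) _ in E.
have GE : G ^+ k.+1 * (1 - 'X^(t.+1) * R) = (1 - 'X^a) ^+ k.+1 * Q.
  rewrite -E mulrA -exprMn; congr (_ ^+ _ * _).
  by rewrite mulrC -opprB mulNr -subrX1 opprB.
have -> : (G ^+ k.+1)`_t = ((1 - 'X^a) ^+ k.+1 * Q)`_t.
  by rewrite -GE mulrBr mulr1 coefB mulrCA coefXnM ltnSn subr0.
rewrite exprBn big_distrl coef_sum /= big_mkord.
rewrite (big_ord_widen k.+2 (fun j => (-1) ^+ j * 'C(k.+1, j)%:R *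
  'C(r + (lambda - j) * a + k, k)%:R)) //.
rewrite [RHS]big_mkcond /=; apply: eq_bigr => j _.
rewrite expr1n mulr1 -exprM mulrnAl -!mulrA coefMn.
have -> (P : {poly int}) : ((-1) ^+ j * P)`_t = (-1) ^+ j * P`_t.
  by rewrite -![(-1) ^+ j]signr_odd; case: (odd j); rewrite ?mulN1r ?coefN // !mul1r.
(* For [j > lambda], [r < a] gives [t < a * j], so the term vanishes. *)
rewrite coefXnM ltnS; case: (leqP j lambda) => lj; last first.
  rewrite ifT ?mulr0 ?mul0rn // /t; have := leq_mul lj (leqnn a); lia.
have tj : (t = a * j + (r + (lambda - j) * a))%N by rewrite /t mulnBl; nia.
rewrite ifF ?coef_poly; last by rewrite tj; lia.
by rewrite {2 3}tj addKn ifT; [rewrite -mulrnAr mulr_natl | lia].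
Qed.

Theorem theorem1p3 (C : nat -> int) (p s k n l r : nat)
    (d : 'I_l.+1 -> 'I_p) :
  strong_divisibility C ->
  ideal_prime C p s ->
  (2 <= k)%N ->
  base_rep n d ->
  (r < rank C p)%N ->
  T p k C (rank C p * n + r)%N =
    (u p k C s r *m (\prod_(i < l.+1) M p k (d i)) *m (e k)^T) 0 0.
Proof.
move=> sdC idp k2 [-> _] ra; have [pr _ s0 _ _] := idp.
rewrite -mulmxA -carry_sum_prod //; set N := (\sum_(i < _) _)%N.
(* No carry enters the lowest position, so the division by the rank starts with [mu = 0]. *)
have -> : T p k C (rank C p * N + r) =
    carry_sum k (fun m => nu p (orial C m)) (rank C p * N + r) 0.
  apply: eq_big => [m|m /eqP E]; rewrite ?addn0 //.
  by rewrite (nu_multinomial sdC p E).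
rewrite (@carry_sum_rec _ _ (fun m => logn p m`!) (rank C p) s) //; last 3 first.
- exact: ltnW.
- exact: nu_orial.
- by move=> q le; apply: leq_trans (sum_logn_fact_le p q) (leq_logn_fact _ le).
rewrite mxE; apply: eq_bigr => lambda _; rewrite !mxE expr0 mul1r subr0 mulrA.
congr (_ * _); rewrite /u_coef mulrC; congr (_ * _).
case: k k2 lambda => // k _ lambda.
rewrite -PoszD.
have := digit_sums_binomial ra (ltnW (ltn_ord lambda)).
move=> /(congr1 (fun z : int => z%:P)); rewrite polyC_natr => ->.
rewrite rmorph_sum; apply: eq_bigr => j _.
by rewrite !rmorphM rmorphXn rmorphN1 !rmorph_nat subn1 /= addnS subn1.
Qed.
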